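(* Let $G$ be a second countable locally compact Hausdorff groupoid with a fixed left Haar system $\lambda=\{\lambda^u\}_{u\in G^0}$, and let $(\Phi,\Psi)$ be a complementary pair of $N$-functions with $\Phi\in\Delta_2$. For $x\in G$ let $L(x):L^\Phi(G^{d(x)})\to L^\Phi(G^{r(x)})$, $(L(x)f)(y)=f(x^{-1}y)$. Then $L$ is a strongly continuous representation of $G$ on the continuous field $(L_0^\Phi,\Delta_1)$, i.e.: (i) each $L(x)$ is an invertible isometry for the gauge norms; (ii) $L(u)$ is the identity of $L^\Phi(G^u)$ for $u\in G^0$; (iii) $L(x)L(y)=L(xy)$ for all composable $(x,y)$; (iv) $L(x)^{-1}=L(x^{-1})$; (v) for every $\eta\in\Delta_1$ the map $x\mapsto L(x)\eta^{d(x)}$ from $G$ to the total space $L_0^\Phi$ is continuous.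
   Context: $G^0$ is the unit space, $r(x)=xx^{-1}$, $d(x)=x^{-1}x$, $G^u=r^{-1}(u)$; the left Haar system consists of positive Radon measures $\lambda^u$ with support $G^u$, $u\mapsto\int f d\lambda^u$ continuous for $f\in C_c(G)$, and $\int f(xy)d\lambda^{d(x)}(y)=\int f(y)d\lambda^{r(x)}(y)$. An $N$-function is a continuous even convex $\Phi:\mathbb R\to[0,\infty)$ with $\Phi(x)=0$ iff $x=0$, $\Phi(x)/x\to0$ as $x\to0$, $\to\infty$ as $x\to\infty$; complementary function $\Psi(y)=\sup_{x\ge0}(x|y|-\Phi(x))$. $\Phi\in\Delta_2$: there is $k>0$ with $\Phi(2x)\le k\Phi(x)$ for all $x\ge0$ ($G$ non-compact), resp. for $x\ge x_0$, some $x_0>0$ ($G$ compact). $L^\Phi(G^u)$: measurable $f$ on $G^u$ with $\int\Phi(\alpha|f|)d\lambda^u<\infty$ for some $\alpha>0$, gauge norm $\|f\|^0_\Phi=\inf\{k>0:\int\Phi(|f|/k)d\lambda^u\le1\}$. The total space is $L_0^\Phi=\bigsqcup_{u\in G^0}L^\Phi(G^u)$ with projection $p$ onto $G^0$. For $f\in C_c(G)$, $f^u=f|_{G^u}$. $\Delta_1$ is the set of sections $\eta=(\eta^u)$, $\eta^u\in L^\Phi(G^u)$, such that for each $u_0\in G^0$ and $\varepsilon>0$ there are $f\in C_c(G)$ and a neighbourhood $V$ of $u_0$ with $\|\eta^v-f^v\|^0_\Phi<\varepsilon$ for $v\in V$. $L_0^\Phi$ carries the topology generated by the sets $U(V,\eta,\varepsilon)=\{h\in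 L_0^\Phi:p(h)\in V,\ \|h-\eta^{p(h)}\|^0_\Phi<\varepsilon\}$, $V\subseteq G^0$ open, $\eta\in\Delta_1$, $\varepsilon>0$. *)

(* Defs.v *)
From HB Require Import structures.
From mathcomp Require Import all_boot all_order all_algebra.
From mathcomp Require Import all_classical all_reals all_analysis.
Set Implicit Arguments. Unset Strict Implicit. Unset Printing Implicit Defensive.
Import Order.TTheory GRing.Theory Num.Theory numFieldNormedType.Exports.
Local Open Scope classical_set_scope.
Local Open Scope ring_scope.

(* Groupoids (Renault's axioms).  [gcomposable x y] is (x,y) in G^2.    *)
Record groupoid (G : Type) := Groupoid {
  gcomposable : G -> G -> Prop;
  gmul : G -> G -> G;
  ginv : G -> G;
  ginvK : forall x, ginv (ginv x) = x;
  gcomposable_assoc : forall x y z, gcomposable x y -> gcomposable y z ->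
     gcomposable (gmul x y) z /\ gcomposable x (gmul y z);
  gmulA : forall x y z, gcomposable x y -> gcomposable y z ->
     gmul (gmul x y) z = gmul x (gmul y z);
  gcomposable_inv : forall x, gcomposable (ginv x) x;
  gmulKV : forall x y, gcomposable x y -> gmul (ginv x) (gmul x y) = y;
  gmulVK : forall x y, gcomposable x y -> gmul (gmul x y) (ginv y) = x }.

Section GroupoidDefs.
Context {G : Type} (gr : groupoid G).
Definition grange (x : G) : G := gmul gr x (ginv gr x).
Definition gsource (x : G) : G := gmul gr (ginv gr x) x.
Definition unit_space : set G := range grange.
Definition fibre (u : G) : set G := grange @^-1` [set u].
End GroupoidDefs.

Definition topological_groupoid (G : topologicalType) (gr : groupoid G) :=
  continuous (ginv gr) /\
  {within [set p : G * G | gcomposable gr p.1 p.2],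
     continuous (fun p : G * G => gmul gr p.1 p.2)}.

Definition borelT (G : ptopologicalType) := g_sigma_algebraType (@open G).

Definition msupport (R : realType) (G : ptopologicalType)
  (mu : {measure set (borelT G) -> \bar R}) : set G :=
  [set x | forall U : set G, open U -> U x -> (0 < mu U)%E].

Definition radon (R : realType) (G : ptopologicalType)
  (mu : {measure set (borelT G) -> \bar R}) :=
  [/\ (forall K : set G, compact K -> (mu K < +oo)%E),
      (forall A : set (borelT G), measurable A ->
         mu A = ereal_inf [set mu U | U in [set U : set G | open U /\ A `<=` U]]) &
      (forall U : set G, open U ->
         mu U = ereal_sup [set mu K | K in [set K : set G | compact K /\ K `<=` U]])].

Definition Cc (R : realType) (G : topologicalType) (f : G -> R) :=
  continuous f /\ compact (closure (f @^-1` [set~ 0])).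

Definition haar_system (R : realType) (G : ptopologicalType) (gr : groupoid G)
  (lam : G -> {measure set (borelT G) -> \bar R}) :=
  [/\ (forall u, unit_space gr u -> radon (lam u)),
      (forall u, unit_space gr u -> msupport (lam u) = fibre gr u),
      (forall f : G -> R, Cc f ->
         {within unit_space gr,
            continuous (fun u => (\int[lam u]_y (f y)%:E)%E)}) &
      (forall f : G -> R, Cc f -> forall x : G,
         (\int[lam (gsource gr x)]_(y in fibre gr (gsource gr x)) (f (gmul gr x y))%:E)%E
         = (\int[lam (grange gr x)]_y (f y)%:E)%E)].

Definition N_function (R : realType) (Phi : R -> R) :=
  [/\ continuous Phi,
      (forall x, Phi (- x) = Phi x),
      (forall x y t, 0 <= t <= 1 ->
         Phi (t * x + (1 - t) * y) <= t * Phi x + (1 - t) * Phi y),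
      (forall x, 0 <= Phi x) &
      (forall x, Phi x = 0 <-> x = 0)] /\
  ((fun x => Phi x / x) @ 0^' --> (0 : R) /\
   (fun x => Phi x / x) @ +oo --> +oo).

Definition complementary (R : realType) (Phi : R -> R) : R -> R :=
  fun y => sup [set x * `|y| - Phi x | x in [set x : R | 0 <= x]].

Definition Delta2 (R : realType) (G : topologicalType) (Phi : R -> R) :=
  if `[< compact [set: G] >] then
    exists k x0 : R, [/\ 0 < k, 0 < x0 &
      forall x, x0 <= x -> Phi (2 * x) <= k * Phi x]
  else
    exists k : R, 0 < k /\ forall x, 0 <= x -> Phi (2 * x) <= k * Phi x.

(* carrier of the total space L_0^Phi (indexed by the data so that it can
   carry its own topology) *)
Definition total_space (R : realType) (G : ptopologicalType) (gr : groupoid G)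
  (lam : G -> {measure set (borelT G) -> \bar R}) (Phi : R -> R) : Type :=
  let _ := (gr, lam, Phi) in (G * (G -> R))%type.

Section Orlicz.
Context {R : realType} {G : ptopologicalType} (gr : groupoid G)
  (lam : G -> {measure set (borelT G) -> \bar R}) (Phi : R -> R).

Definition LPhi (u : G) (f : G -> R) :=
  measurable_fun (fibre gr u : set (borelT G)) (f : borelT G -> R) /\
  exists a : R, 0 < a /\
    (\int[lam u]_(y in fibre gr u) (Phi (a * `|f y|))%:E < +oo)%E.

Definition gauge_norm (u : G) (f : G -> R) : R :=
  inf [set k : R | 0 < k /\
    (\int[lam u]_(y in fibre gr u) (Phi (`|f y| / k))%:E <= 1)%E].

(* equality in L^Phi(G^u), i.e. lambda^u-a.e. on G^u *)
Definition fibre_ae_eq (u : G) (f g : G -> R) :=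
  {ae lam u, forall y : borelT G, fibre gr u y -> f y = g y}.

Definition Ltrans (x : G) (f : G -> R) : G -> R :=
  fun y => f (gmul gr (ginv gr x) y).

Definition Delta1 (eta : G -> G -> R) :=
  (forall u, unit_space gr u -> LPhi u (eta u)) /\
  forall u0, unit_space gr u0 -> forall eps : R, 0 < eps ->
    exists f : G -> R, Cc f /\
      exists V : set G, [/\ open V, V u0 &
        forall v, unit_space gr v -> V v -> gauge_norm v (eta v \- f) < eps].

(* total space L_0^Phi: pairs (u, h) with u in G^0 and h in L^Phi(G^u);
   carried by G * (G -> R), with the topology generated by the sets
   U(V, eta, eps). *)
Local Notation L0 := (total_space gr lam Phi).
HB.instance Definition _ := Choice.on L0.

Definition total_subbase_index : pointedType :=
  (set G * (G -> G -> R) * R)%type.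

Definition total_subbase_dom : set total_subbase_index :=
  [set i | [/\ open i.1.1, Delta1 i.1.2 & 0 < i.2]].

Definition total_subbase (i : total_subbase_index) : set L0 :=
  [set h | [/\ unit_space gr h.1, LPhi h.1 h.2, i.1.1 h.1 &
              gauge_norm h.1 (h.2 \- i.1.2 h.1) < i.2]].

HB.instance Definition _ :=
  isSubBaseTopological.Build L0 total_subbase_dom total_subbase.

End Orlicz.

(* Main.v *)
Require Import Defs.
From HB Require Import structures.
From mathcomp Require Import all_boot all_order all_algebra finmap lra.
From mathcomp Require Import all_classical all_reals all_analysis measurable_realfun.
Import Order.TTheory GRing.Theory Num.Theory numFieldNormedType.Exports.
Local Open Scope classical_set_scope.
Local Open Scope ring_scope.

(* Inner regularity, Urysohn functions and the invariance of the Haar system on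
   C_c(G) give lambda^{d(x)}(x^{-1}U) <= lambda^{r(x)}(U) for open U; outer
   regularity extends this to Borel sets, and applying it to both x and x^{-1}
   gives equality.  Hence modulars are translation invariant, which makes L(x) an
   isometry, while (ii)-(iv) are pointwise groupoid identities.
   For (v), approximate eta near d(x0) by f in C_c(G), and extend the function
   y |-> f(x0^{-1}y) from the closed fibre G^{r(x0)} to some h in C_c(G) (Tietze).
   A tube argument on a compact set shows ||L(x)f - h||_{r(x)} -> 0 as x -> x0, and
   u |-> ||h - g||_u is upper semicontinuous for every g in C_c(G), in particular
   for an approximation g of the section defining a basic neighbourhood. *)

(** * Groupoid algebra: units, composability, cancellation *)

Section GroupoidAlgebra.
Context {G : Type} (gr : groupoid G).
Local Notation inv := (ginv gr).
Local Notation mul := (gmul gr).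
Local Notation r := (grange gr).
Local Notation d := (gsource gr).
Local Notation comp := (gcomposable gr).

Lemma gcomposable_invr x : comp x (inv x).
Proof. by have := gcomposable_inv gr (inv x); rewrite ginvK. Qed.

Lemma grange_inv x : r (inv x) = d x.
Proof. by rewrite /grange ginvK. Qed.

Lemma gsource_inv x : d (inv x) = r x.
Proof. by rewrite /gsource ginvK. Qed.

Lemma gmul_grangel x : mul (r x) x = x.
Proof. by rewrite -[X in mul _ X](ginvK gr) gmulVK//; exact: gcomposable_invr. Qed.

Lemma gmul_gsourcer x : mul x (d x) = x.
Proof.
have := gmulKV (gcomposable_inv gr x).
by rewrite ginvK.
Qed.

(** Forward: computing [((x^-1 x) y) y^-1] in two ways gives [d x] and [r y]. Backward: [x] composes
    with [d x] and [r y] composes with [y]; when these units agree, [x (d x) = x] composes with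
    [y]. *)
Lemma gcomposableP x y : comp x y <-> d x = r y.
Proof.
split=> [xy|dr].
  have [c1 c2] := gcomposable_assoc (gcomposable_inv gr x) xy.
  have := gmulVK c1.
  rewrite [mul (mul (inv x) x) y]gmulA//; last exact: gcomposable_inv.
  by rewrite gmulKV.
have [_ c1] := gcomposable_assoc (gcomposable_invr x) (gcomposable_inv gr x).
have [c2 _] := gcomposable_assoc (gcomposable_invr y) (gcomposable_inv gr y).
rewrite -/(d x) dr in c1; rewrite -/(r y) in c2.
have [+ _] := gcomposable_assoc c1 c2.
by rewrite -dr gmul_gsourcer.
Qed.

Lemma grange_mul x y : d x = r y -> r (mul x y) = r x.
Proof.
move=> /gcomposableP xy.
have [_ /gcomposableP <-] := gcomposable_assoc (gcomposable_inv gr x) xy.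
exact: gsource_inv.
Qed.

Lemma grange_mulV x y : r x = r y -> r (mul (inv x) y) = d x.
Proof. by move=> xy; rewrite grange_mul ?grange_inv// gsource_inv. Qed.

Lemma gmulK x y : d x = r y -> mul (inv x) (mul x y) = y.
Proof. by move=> /gcomposableP; exact: gmulKV. Qed.

Lemma gmulKr x y : r x = r y -> mul x (mul (inv x) y) = y.
Proof. by move=> xy; rewrite -{1}(ginvK gr x) gmulK// gsource_inv. Qed.

Lemma unit_space_range x : unit_space gr (r x).
Proof. by exists x. Qed.

Lemma unit_space_source x : unit_space gr (d x).
Proof. by exists (inv x) => //; rewrite grange_inv. Qed.

Lemma gmul_invl_unit u y : unit_space gr u -> r y = u -> mul (inv u) y = y.
Proof.
move=> uu <-; have /gcomposableP c : d (r y) = r y.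
  have [c _] := gcomposable_assoc (gcomposable_invr y) (gcomposable_inv gr y).
  by apply/gcomposableP.
by rewrite -{2}(gmul_grangel y) gmulKV.
Qed.

(** Writing [w = (x y) v] with [v = y^-1 (x^-1 w)] and cancelling [x y] avoids a formula for the
    inverse of a product. *)
Lemma gmul_invM x y w : d x = r y -> r w = r x ->
  mul (inv y) (mul (inv x) w) = mul (inv (mul x y)) w.
Proof.
move=> xy wx; set v := mul (inv y) _.
have yv : d y = r v by rewrite /v grange_mulV// grange_mulV.
have -> : w = mul (mul x y) v.
  rewrite gmulA; try exact/gcomposableP.
  by rewrite /v gmulKr ?grange_mulV// gmulKr.
rewrite gmulK//; apply/gcomposableP.
by have [] := @gcomposable_assoc _ gr x y v (proj2 (gcomposableP _ _) xy)
  (proj2 (gcomposableP _ _) yv).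
Qed.

End GroupoidAlgebra.

(** * Continuity of range, source and translations *)

Section TopologicalGroupoid.
Context {G : topologicalType} (gr : groupoid G).
Hypothesis hG : hausdorff_space G.
Hypothesis tG : topological_groupoid gr.
Local Notation inv := (ginv gr).
Local Notation mul := (gmul gr).
Local Notation r := (grange gr).
Local Notation d := (gsource gr).

(** Multiplication is continuous only relative to the set of composable pairs, so the factors must
    be composable eventually along the filter. *)
Lemma gmul_cvg {T : Type} (F : set_system T) {FF : Filter F} (f g : T -> G) a b :
  d a = r b -> f @ F --> a -> g @ F --> b ->
  (\forall t \near F, d (f t) = r (g t)) ->
  (fun t => mul (f t) (g t)) @ F --> mul a b.
Proof.
move=> ab fa gb fg; have [_] := tG.
rewrite subspace_continuousP => /(_ (a, b)) /=.
move=> /(_ (proj2 (gcomposableP gr _ _) ab)) H.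
move=> A /H /= HA.
have : (fun t => (f t, g t)) @ F --> (a, b) by exact: cvg_pair.
move=> /(_ _ HA) /= H2.
rewrite /= nbhs_simpl/=.
near=> t.
have : ([set p : G * G | gcomposable gr p.1 p.2] (f t, g t) -> A (mul (f t) (g t))).
  by near: t; exact: H2.
apply; apply/gcomposableP.
by near: t.
Unshelve. all: by end_near. Qed.

Lemma continuous_grange : continuous r.
Proof.
move=> x; apply: gmul_cvg.
- by rewrite grange_inv.
- exact: cvg_id.
- exact: (proj1 tG).
- by near=> t; rewrite grange_inv.
Unshelve. all: by end_near. Qed.

Lemma continuous_gsource : continuous d.
Proof.
move=> x; rewrite (_ : d = r \o inv); last by apply/funext => y /=; rewrite grange_inv.
by apply: continuous_comp; [exact: (proj1 tG)|exact: continuous_grange].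
Qed.

Lemma closed_eq2 {T : topologicalType} (f g : T -> G) :
  continuous f -> continuous g -> closed [set t | f t = g t].
Proof.
move=> cf cg t clt; apply: hG => A B fA gB.
have [|s [/= fg [As Bs]]] := clt ((f @^-1` A) `&` (g @^-1` B)).
  by apply: filterI; [exact: cf|exact: cg].
by exists (f s); split => //; rewrite fg.
Qed.

Lemma closed_fibre u : closed (fibre gr u).
Proof. apply: closed_eq2; [exact: continuous_grange | exact: cst_continuous]. Qed.

Lemma within_continuous_translate x :
  {within fibre gr (d x), continuous (mul x)}.
Proof.
apply/subspace_continuousP => y yx; apply: gmul_cvg => //.
- exact: cvg_cst.
- exact: cvg_within.
- by rewrite near_withinE; near=> z => ->.
Unshelve. all: by end_near. Qed.

End TopologicalGroupoid.

(** * Urysohn and Tietze theorems with compact supports *)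

Section CompactSupport.
Context {R : realType} {G : topologicalType}.
Hypothesis hG : hausdorff_space G.
Hypothesis lcG : locally_compact [set: G].

Let opc_normal : normal_space (one_point_compactification G).
Proof.
apply: compact_normal; first exact: one_point_compactification_hausdorff.
exact: one_point_compactification_compact.
Qed.

Let closed_Some (K : set G) : compact K ->
  closed (Some @` K : set (one_point_compactification G)).
Proof.
move=> cK; apply: compact_closed; first exact: one_point_compactification_hausdorff.
apply: continuous_compact => //; apply: continuous_subspaceT.
exact: one_point_compactification_some_continuous.
Qed.

(** The one-point compactification is compact Hausdorff, hence normal. Urysohn there gives [g] equal
    to 1 on [K] and to -1 off [U], in particular at infinity; [f] is the positive part of [g]. The
    lower value -1 instead of 0 makes [f] vanish on a whole neighbourhood of infinity, so that its
    support is compact. *)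
Lemma Cc_urysohn (K U : set G) : compact K -> open U -> K `<=` U ->
  exists f : G -> R, [/\ Cc f, forall x, 0 <= f x <= 1,
    forall x, K x -> f x = 1 & forall x, ~ U x -> f x = 0].
Proof.
move=> cK oU KU.
have cB : closed (~` (Some @` U) : set (one_point_compactification G)).
  exact/open_closedC/one_point_compactification_open_some.
have [||g [cg gB gA g01]] := @urysohn_ext_itv _ R opc_normal _ _ (-1) 1 cB (closed_Some _ cK).
- apply/seteqP; split => // -[y|] [] //= ny; last by case=> z.
  by move=> -[z Kz [zy]]; apply: ny; exists z; [exact: KU|rewrite zy].
- by rewrite -subr_gt0 opprK addr_gt0.
pose f x := Num.max 0 (g (Some x)).
have cgS : continuous (fun x => g (Some x)).
  move=> x; apply: (@continuous_comp _ (one_point_compactification G)); last exact: cg.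
  exact: one_point_compactification_some_continuous.
have gle1 x : -1 <= g x <= 1 by have := g01 (g x) (ex_intro2 _ _ _ I erefl); rewrite /= in_itv.
exists f; split.
- split.
    move=> x; apply: (@continuous_max R _ (fun=> 0) (fun x => g (Some x)) x).
      exact: cvg_cst.
    exact: cgS.
  have gN : g None = -1 by apply: gB; exists None => //= -[z].
  have : nbhs (None : one_point_compactification G) (g @^-1` [set y | y < 0]).
    have H : g @ (None : one_point_compactification G) --> (-1 : R).
      by rewrite -gN; exact: cg.
    apply: (H [set y | y < 0]); apply: open_nbhs_nbhs.
    by split; [exact: open_lt|rewrite /= ltrN10].
  (* A neighbourhood of infinity on which [g] is negative contains the complement of a closed
     compact [C], which then contains the support of [f]. *)
  move=> [C [cC clC] CN].
  apply: (subclosed_compact _ cC); first exact: closed_closure.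
  rewrite [X in _ `<=` X](_ : C = closure C); last exact/closure_id.
  apply: closureS => x; apply: contra_notP => nC.
  have /= : [set y | y < 0] (g (Some x)) by apply: CN; left; exists x.
  by move=> /ltW gx0; rewrite /f max_l.
- move=> x; rewrite /f le_max lexx/= ge_max ler01/=; by have /andP[] := gle1 (Some x).
- by move=> x Kx; rewrite /f (gA (g (Some x))) ?max_r ?ler01//; exists (Some x) => //; exists x.
- move=> x Ux; rewrite /f (gB (g (Some x))) ?max_l ?lerN10//; exists (Some x) => //=.
  by move=> [z Uz [zx]]; apply: Ux; rewrite -zx.
Qed.

Lemma continuous_compact_bound (K : set G) (f : G -> R) : compact K ->
  {within K, continuous f} -> exists2 M, 0 < M & forall x, K x -> `|f x| <= M.
Proof.
move=> cK cf; have /compact_bounded [M [_ Mb]] := continuous_compact cf cK.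
exists (Num.max M 0 + 1); first by rewrite ltr_wpDl// le_max lexx orbT.
move=> x Kx; apply: (Mb (Num.max M 0 + 1)); last by exists x.
by rewrite ltr_pwDr// le_max lexx.
Qed.

(** The extension is a cut-off [phi], equal to 1 on [C], times a Tietze extension in the one-point
    compactification. There [A] may fail to be closed and [f] to be bounded, so Tietze starts from
    the compact intersection of [A] with the support of [phi]. On the rest of [A] both [phi] and [f]
    vanish. *)
Lemma Cc_extension (A C : set G) (f : G -> R) :
  closed A -> {within A, continuous f} -> compact C ->
  (forall x, A x -> f x <> 0 -> C x) ->
  exists2 h : G -> R, Cc h & forall x, A x -> h x = f x.
Proof.
move=> cA cf cC supp.
have [phi [[cphi cD] phi01 phi1 _]] := Cc_urysohn C setT cC openT (@subsetT _ _).
pose D := closure (phi @^-1` [set~ 0]).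
have cS : compact (A `&` D) by rewrite setIC; exact: compact_closedI.
have wS : {within A `&` D, continuous f} by apply: continuous_subspaceW cf; exact: subIsetl.
have [M M0 Mb] := continuous_compact_bound _ _ cS wS.
pose f' (z : one_point_compactification G) := if z is Some x then f x else 0.
have [||g [fg cg _]] := @continuous_bounded_extension _ R opc_normal _ (closed_Some _ cS) f' M M0.
- apply/subspace_continuousP => -[x|] [y Sy]// [yx]; subst y.
  have /subspace_continuousP/(_ x Sy) H := wS.
  move=> B /H HB.
  have {}HB : nbhs x [set z | (A `&` D) z -> B (f z)] by exact: HB.
  have HS : nbhs (Some x : one_point_compactification G)
      [set z | (Some @` (A `&` D)) z -> B (f' z)].
    rewrite /nbhs/= nbhs_simpl; apply: filterS HB => z zB [y yS [yz]].
    by rewrite yz in yS; exact: zB.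
  exact: HS.
- by move=> _ [y Sy <-]; exact: Mb.
exists (fun x => phi x * g (Some x)).
  split.
    move=> x; apply: continuousM; first exact: cphi.
    apply: (@continuous_comp _ (one_point_compactification G)); last exact: cg.
    exact: one_point_compactification_some_continuous.
  apply: (subclosed_compact _ cD); first exact: closed_closure.
  by apply: closureS => x /= xn px; apply: xn; rewrite px mul0r.
move=> x Ax; have [Dx|Dx] := pselect (D x).
  rewrite -(fg (Some x)) ?inE /f'; last by exists x.
  have [fx|/eqP fx] := eqVneq (f x) 0; first by rewrite fx mulr0.
  by rewrite phi1 ?mul1r//; exact: supp.
have p0 : phi x = 0 by apply: contra_notP Dx => px; exact: subset_closure.
rewrite p0 mul0r; apply/esym; apply: contra_notP Dx => fx.
apply: subset_closure => /=; rewrite phi1; first exact/eqP/oner_neq0.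
exact: supp.
Qed.

End CompactSupport.

(** * Borel measurability of relatively continuous maps *)

Section BorelMeasurability.
Context {R : realType} {G : ptopologicalType}.

Lemma open_borel (U : set G) : open U -> measurable (U : set (borelT G)).
Proof. by move=> oU; apply: sub_sigma_algebra. Qed.

Lemma closed_borel (A : set G) : closed A -> measurable (A : set (borelT G)).
Proof.
move=> cA; rewrite -(setCK A); apply: measurableC.
by apply: open_borel; exact: closed_openC.
Qed.

Lemma within_continuous_borel_real (A : set G) (f : G -> R) :
  measurable (A : set (borelT G)) -> {within A, continuous f} ->
  measurable_fun (A : set (borelT G)) (f : borelT G -> R).
Proof.
move=> mA /continuousP cf; apply: (measurability _ (RGenOpens.measurableE R)).
move=> _ [_ [a [b ->] <-]].
have oI : open (`]a, b[%classic : set R) by exact: interval_open.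
have /open_subspaceP [V oV VA] := cf _ oI.
rewrite [X in measurable X](_ : _ = A `&` V); last by rewrite setIC [RHS]setIC VA.
by apply: measurableI => //; exact: open_borel.
Qed.

Lemma within_continuous_borel (A : set G) (f : G -> G) :
  measurable (A : set (borelT G)) -> {within A, continuous f} ->
  measurable_fun (A : set (borelT G)) (f : borelT G -> borelT G).
Proof.
move=> mA /continuousP cf; apply: (@measurability _ _ _ (borelT G) _ _ (@open G)) => //.
move=> _ [U oU <-].
have /open_subspaceP [V oV VA] := cf _ oU.
rewrite [X in measurable X](_ : _ = A `&` V); last by rewrite setIC [RHS]setIC VA.
by apply: measurableI => //; exact: open_borel.
Qed.

Lemma continuous_borel_real (f : G -> R) : continuous f ->
  measurable_fun (setT : set (borelT G)) (f : borelT G -> R).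
Proof.
by move=> cf; apply: within_continuous_borel_real => //; exact: continuous_subspaceT.
Qed.

End BorelMeasurability.

(** * Translation invariance of the Haar system on Borel sets *)

Section HaarTranslation.
Context {R : realType} {G : ptopologicalType} {gr : groupoid G}
  {lam : G -> {measure set (borelT G) -> \bar R}}.
Hypothesis hG : hausdorff_space G.
Hypothesis lcG : locally_compact [set: G].
Hypothesis tG : topological_groupoid gr.
Hypothesis haar : haar_system gr lam.
Local Notation inv := (ginv gr).
Local Notation mul := (gmul gr).
Local Notation r := (grange gr).
Local Notation d := (gsource gr).
Local Notation F := (fibre gr).

Lemma fibre_borel u : measurable (F u : set (borelT G)).
Proof. by apply: closed_borel; exact: closed_fibre. Qed.
Local Hint Resolve fibre_borel : core.

(** Points off the support have open null neighbourhoods; finitely many of them cover a compact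
    subset of the complement, which is therefore null. Inner regularity on the open complement
    concludes. *)
Lemma haar_fibreC u : unit_space gr u -> lam u (~` F u) = 0%E.
Proof.
move=> uu; have [rad supp _ _] := haar; have [_ _ inn] := rad u uu.
have oF : open (~` F u) by exact/closed_openC/closed_fibre.
apply/eqP; rewrite eq_le measure_ge0 andbT inn//.
apply: ge_ereal_sup => _ [K [cK KF] <-].
pose D := [set U : set G | open U /\ lam u U = 0%E].
have KD : K `<=` cover D id.
  move=> y /KF; rewrite -(supp u uu) /msupport /= => /existsNP [U].
  move=> /not_implyP [oU] /not_implyP [Uy] /negP; rewrite -leNgt => U0.
  by exists U => //; split => //; apply/eqP; rewrite eq_le U0 measure_ge0.
have := cK; rewrite compact_cover => /(_ _ D id) [|//|D' D'D KD'].
  by move=> U [].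
have neg : (lam u).-negligible (cover [set` D'] id).
  rewrite /cover bigcup_fset; rewrite big_seq.
  elim/big_ind : _ => [|A B nA nB|U UD']; [exact: negligible_set0|exact: negligibleU|].
  have /D'D := UD'; rewrite inE => -[oU U0].
  by exists U; split => //; exact: open_borel.
have mK : measurable (K : set (borelT G)) by apply: closed_borel; exact: compact_closed.
have /(negligibleP (lam u) mK) -> // : (lam u).-negligible (K : set (borelT G)).
exact: negligibleS neg.
Qed.

Lemma haar_setI_fibre u (A : set (borelT G)) : unit_space gr u -> measurable A ->
  lam u (A `&` F u) = lam u A.
Proof.
move=> uu mA; rewrite [RHS](measureDI _ mA (fibre_borel u)).
rewrite [X in _ = (X + _)%E](_ : _ = 0%E) ?add0e//.
apply: (subset_measure0 _ _ _ (haar_fibreC _ uu)).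
- exact: measurableD.
- exact: measurableC.
- exact: subIsetr.
Qed.

Lemma measurable_translate x :
  measurable_fun (F (d x) : set (borelT G)) (mul x : borelT G -> borelT G).
Proof. by apply: within_continuous_borel => //; exact: within_continuous_translate. Qed.

Let haar_le_open x (U : set G) : open U ->
  (lam (d x) (F (d x) `&` mul x @^-1` U) <= lam (r x) U)%E.
Proof.
move=> oU; have [rad _ _ inva] := haar.
have wc := within_continuous_translate gr tG x.
(* The preimage of [U] is only relatively open in the fibre. The open set [W] has the same trace,
   hence the same measure, and inner regularity applies to it. *)
have /continuousP/(_ _ oU)/open_subspaceP [W oW WF] := wc.
rewrite [X in lam _ X](_ : _ = W `&` F (d x)); last by rewrite WF setIC.
rewrite haar_setI_fibre; [|exact: unit_space_source|exact: open_borel].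
have [_ _ inn] := rad _ (unit_space_source gr x).
rewrite inn//; apply: ge_ereal_sup => _ [K [cK KW] <-].
have mK : measurable (K : set (borelT G)) by apply: closed_borel; exact: compact_closed.
rewrite -haar_setI_fibre//; last exact: unit_space_source.
set K1 := K `&` F (d x).
have cK1 : compact K1 by apply: compact_closedI => //; exact: closed_fibre.
have mK1 : measurable (K1 : set (borelT G)) by apply: closed_borel; exact: compact_closed.
have cK2 : compact (mul x @` K1).
  apply: continuous_compact => //; apply: continuous_subspaceW wc; exact: subIsetr.
have [|phi [phiC phi01 phi1 phi0]] := @Cc_urysohn R G hG lcG _ U cK2 oU.
  move=> _ [y [Ky Fy] <-]; have : (W `&` F (d x)) y by split => //; exact: KW.
  by rewrite WF => -[].
have mphi := continuous_borel_real _ (proj1 phiC).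
have phige y : 0 <= phi y by have /andP[] := phi01 y.
have K1F : K1 `&` F (d x) = K1 by rewrite /K1 -setIA setIid.
rewrite -K1F -(integral_indic (lam (d x)) (fibre_borel (d x)) mK1).
(* The indicator of [K1] at [y] is at most [phi (x y)], and [phi] is at most the indicator of [U];
   invariance on [Cc] links the two integrals. *)
apply: (@le_trans _ _ (\int[lam (d x)]_(y in F (d x)) (phi (mul x y))%:E)%E).
  apply: ge0_le_integral => //; try by move=> y _; rewrite lee_fin.
  - by apply/measurable_EFinP; exact: measurable_indic.
  - apply/measurable_EFinP.
    exact: (measurableT_comp mphi (measurable_translate x)).
  - move=> y Fy; rewrite lee_fin indicE; have [|_] := boolP (y \in K1); last exact: phige.
    by rewrite inE => Ky; rewrite phi1//; exists y.
rewrite (inva _ phiC) -(setIT U) -(integral_indic (lam (r x)) measurableT (open_borel _ oU)).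
apply: ge0_le_integral => //; try by move=> y _; rewrite lee_fin.
- exact/measurable_EFinP.
- apply/measurable_EFinP; apply: measurable_indic; exact: open_borel.
- move=> y _; rewrite lee_fin indicE; have [|] := boolP (y \in U).
    by have /andP[] := phi01 y.
  by rewrite notin_setE => /phi0 ->.
Qed.

Let haar_le x (A : set (borelT G)) : measurable A ->
  (lam (d x) (F (d x) `&` mul x @^-1` A) <= lam (r x) A)%E.
Proof.
move=> mA; have [rad _ _ _] := haar.
have [_ out _] := rad _ (unit_space_range gr x); rewrite out//.
apply: le_ereal_inf_tmp => _ [U [oU AU] <-].
apply: (le_trans _ (haar_le_open x U oU)).
apply: le_measure; rewrite ?inE.
- exact: measurable_translate.
- by apply: measurable_translate => //; exact: open_borel.
- by apply: setIS; exact: preimage_subset.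
Qed.

Lemma haar_translate x (A : set (borelT G)) : measurable A ->
  lam (d x) (F (d x) `&` mul x @^-1` A) = lam (r x) A.
Proof.
move=> mA; apply/eqP; rewrite eq_le haar_le//=.
have mB : measurable (F (d x) `&` mul x @^-1` A : set (borelT G)) by exact: measurable_translate.
(* The inequality for [inv x], applied to the pulled back set: pulling back once more recovers the
   part of [A] in the fibre. *)
have := haar_le (inv x) _ mB; rewrite gsource_inv grange_inv; apply: le_trans.
rewrite -(haar_setI_fibre (r x) A (unit_space_range gr x) mA).
rewrite le_eqVlt; apply/orP; left; apply/eqP; congr (lam _ _).
apply/seteqP; split => y /= [].
  move=> Ay Fy; split => //; split; first by rewrite /fibre/= grange_mulV// Fy.
  by rewrite gmulKr// Fy.
by move=> Fy []; rewrite gmulKr// Fy.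
Qed.

(** Set-level invariance identifies the pushforward of [lam (r x)] under translation by [inv x] with
    [lam (d x)]; the rest is change of variables. *)
Lemma integral_translate x (g : G -> \bar R) :
  measurable_fun (F (d x) : set (borelT G)) (g : borelT G -> \bar R) ->
  (forall y, F (d x) y -> (0 <= g y)%E) ->
  (\int[lam (r x)]_(z in F (r x)) g (mul (inv x) z) =
   \int[lam (d x)]_(y in F (d x)) g y)%E.
Proof.
move=> mg g0.
(* A pushforward takes a map measurable on all of [G], so the translation is continued by the
   identity off the fibre. *)
pose T (z : borelT G) : borelT G := if `[< F (r x) z >] then mul (inv x) z else z.
have mT : measurable_fun setT T.
  move=> _ A mA; rewrite setTI [X in measurable X](_ : _ =
    (F (r x) `&` mul (inv x) @^-1` A) `|` (A `\` F (r x))); last first.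
    apply/seteqP; split => z /=; rewrite /T; case: asboolP => Fz.
    - by move=> Az; left.
    - by move=> Az; right.
    - by move=> [[]|[]].
    - by move=> [[]|[]].
  apply: measurableU; last exact: measurableD.
  by have := measurable_translate (inv x); rewrite gsource_inv; exact.
have TF z : F (r x) z -> T z = mul (inv x) z by move=> Fz; rewrite /T asboolT.
have sub : F (r x) `<=` T @^-1` F (d x).
  by move=> z Fz; rewrite /= TF// /fibre/= grange_mulV.
have mTF : measurable (T @^-1` F (d x)) by rewrite -[X in measurable X]setTI; exact: mT.
have mgT : measurable_fun (T @^-1` F (d x)) (g \o T).
  apply: (measurable_comp (fibre_borel (d x)) _ mg); last exact: measurable_funTS.
  by move=> _ [z Fz <-].
transitivity (\int[pushforward (lam (r x)) T]_(y in F (d x)) g y)%E.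
  rewrite (ge0_integral_pushforward mT (lam (r x)) (fibre_borel (d x)) mg); last first.
    by move=> y /set_mem Fy; exact: g0.
  (* The preimage of [F (d x)] can exceed [F (r x)] by points where [T] is the identity; these form
     a null set. *)
  rewrite (@ge0_negligible_integral _ _ _ (lam (r x)) (T @^-1` F (d x)) (~` F (r x)))//.
  - rewrite setDE setCK (setIidr sub).
    by apply: eq_integral => z; rewrite inE => Fz /=; rewrite TF.
  - exact: measurableC.
  - by move=> z /= Fz; exact: g0.
  - by apply: haar_fibreC; exact: unit_space_range.
apply: eq_measure_integral => A mA AF; transitivity (lam (r x) (T @^-1` A)) => //.
have mTA : measurable (T @^-1` A) by rewrite -[X in measurable X]setTI; exact: mT.
rewrite -(haar_setI_fibre (r x) _ (unit_space_range gr x) mTA).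
have := haar_translate (inv x) _ mA; rewrite gsource_inv grange_inv => <-.
congr (lam _ _); apply/seteqP; split => z /= [].
  by move=> + Fz; rewrite TF.
by move=> Fz; rewrite TF.
Qed.

(** Modulars integrate over the fibre, whereas continuity of the Haar system concerns integrals over
    [G]; this passes between the two. *)
Lemma integral_fibre u (g : G -> \bar R) : unit_space gr u ->
  measurable_fun (setT : set (borelT G)) (g : borelT G -> \bar R) ->
  (forall y, (0 <= g y)%E) ->
  (\int[lam u]_(y in F u) g y = \int[lam u]_y g y)%E.
Proof.
move=> uu mg g0; rewrite (@ge0_negligible_integral _ _ _ (lam u) setT (~` F u))//.
- by rewrite setTD setCK.
- exact: measurableC.
- exact: haar_fibreC.
Qed.

End HaarTranslation.

(** * Scaling and monotonicity of N-functions *)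

Section NFunction.
Context {R : realType} {Phi : R -> R}.
Hypothesis hPhi : N_function Phi.

Lemma N_function0 : Phi 0 = 0.
Proof. by have [[_ _ _ _ P0] _] := hPhi; apply/P0. Qed.

Lemma N_function_ge0 x : 0 <= Phi x.
Proof. by have [[_ _ _ P0 _] _] := hPhi. Qed.

Lemma N_function_continuous : continuous Phi.
Proof. by have [[]] := hPhi. Qed.

(** Convexity between [s] and 0, where [Phi] vanishes. *)
Lemma N_function_scale t s : 0 <= t <= 1 -> Phi (t * s) <= t * Phi s.
Proof.
move=> t01; have [[_ _ /(_ s 0 t t01) + _ _] _] := hPhi.
by rewrite N_function0 !mulr0 !addr0.
Qed.

Lemma N_function_mono a b : 0 <= a -> a <= b -> Phi a <= Phi b.
Proof.
move=> a0 ab; have [b0|b0] := eqVneq b 0.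
  by rewrite (_ : a = b)//; apply/eqP; rewrite eq_le ab b0.
have b1 : 0 < b by rewrite lt_neqAle eq_sym b0 (le_trans a0).
have t01 : 0 <= a / b <= 1.
  by rewrite divr_ge0 ?(ltW b1)//= ler_pdivrMr// mul1r.
rewrite -{1}(divfK b0 a) (le_trans (N_function_scale _ b t01))//.
by rewrite ler_piMl ?N_function_ge0//; have /andP[] := t01.
Qed.

End NFunction.

(** * The gauge norm through its admissible radii *)

Section GaugeBall.
Context {R : realType} {G : ptopologicalType} {gr : groupoid G}
  {lam : G -> {measure set (borelT G) -> \bar R}} {Phi : R -> R}.
Hypothesis hG : hausdorff_space G.
Hypothesis tG : topological_groupoid gr.
Hypothesis hPhi : N_function Phi.
Local Notation F := (fibre gr).
Local Notation fmeasurable u f :=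
  (measurable_fun (F u : set (borelT G)) (f : borelT G -> R)).

Local Hint Extern 0 (measurable (fibre _ _)) => (exact: fibre_borel hG tG _) : core.

(** The gauge norm is the infimum of these [k]. Estimates are carried out at a fixed radius, and
    infima enter only at the two ends, in [gauge_norm_lt] and [gauge_norm_le]. *)
Definition gauge_ball u (k : R) (f : G -> R) :=
  0 < k /\ (\int[lam u]_(y in F u) (Phi (`|f y| / k))%:E <= 1)%E.

Lemma measurable_modular u (f : G -> R) (k : R) : fmeasurable u f ->
  measurable_fun (F u : set (borelT G)) (fun y : borelT G => (Phi (`|f y| / k))%:E).
Proof.
move=> mf; apply/measurable_EFinP.
apply: (measurableT_comp (continuous_measurable_fun (N_function_continuous hPhi))).
apply: measurable_funM => //; exact: measurableT_comp.
Qed.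

(** Comparing the quotients covers pointwise domination and a change of radius at once. *)
Lemma gauge_ball_dom u k l f g : fmeasurable u f -> fmeasurable u g -> 0 < l ->
  (forall y, F u y -> `|f y| / l <= `|g y| / k) ->
  gauge_ball u k g -> gauge_ball u l f.
Proof.
move=> mf mg l0 fg [k0 gk]; split => //; apply: le_trans gk.
apply: ge0_le_integral => //.
- by move=> y _; rewrite lee_fin N_function_ge0.
- exact: measurable_modular.
- exact: measurable_modular.
- move=> y Fy; rewrite lee_fin; apply: N_function_mono => //; last exact: fg.
  by rewrite divr_ge0// ltW.
Qed.

Lemma gauge_ball_le u k l f : fmeasurable u f -> k <= l ->
  gauge_ball u k f -> gauge_ball u l f.
Proof.
move=> mf kl fk; have [k0 _] := fk; have l0 : 0 < l by exact: lt_le_trans kl.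
apply: (gauge_ball_dom u k l f f) => // y _.
by apply: ler_wpM2l => //; rewrite lef_pV2.
Qed.

(** Minkowski's inequality: [(|f| + |g|) / (k + l)] is the convex combination of [|f| / k] and
    [|g| / l] with weights [k / (k + l)] and [l / (k + l)]. *)
Lemma gauge_ball_add u k l f g h :
  fmeasurable u f -> fmeasurable u g -> fmeasurable u h ->
  (forall y, F u y -> `|h y| <= `|f y| + `|g y|) ->
  gauge_ball u k f -> gauge_ball u l g -> gauge_ball u (k + l) h.
Proof.
move=> mf mg mh hfg [k0 fk] [l0 gl]; have kl0 : 0 < k + l by exact: addr_gt0.
split => //.
pose s := k / (k + l); pose t := l / (k + l).
have s0 : 0 <= s by rewrite divr_ge0// ltW.
have t0 : 0 <= t by rewrite divr_ge0// ltW.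
have st : s + t = 1 by rewrite -mulrDl divff// gt_eqF.
apply: (@le_trans _ _ (\int[lam u]_(y in F u)
   (s%:E * (Phi (`|f y| / k))%:E + t%:E * (Phi (`|g y| / l))%:E))%E).
  apply: ge0_le_integral => //.
  - by move=> y _; rewrite lee_fin N_function_ge0.
  - exact: measurable_modular.
  - by apply: emeasurable_funD; apply: measurable_funeM; exact: measurable_modular.
  - move=> y Fy; rewrite -!EFinM -EFinD lee_fin.
    have [[_ _ convex _ _] _] := hPhi.
    have -> : t = 1 - s by rewrite -st addrAC subrr add0r.
    apply: le_trans (convex _ _ _ _); last by rewrite s0 -st lerDl.
    apply: N_function_mono => //; first by rewrite divr_ge0// ltW.
    have -> : 1 - s = t by rewrite -st addrAC subrr add0r.
    have -> : s * (`|f y| / k) + t * (`|g y| / l) = (`|f y| + `|g y|) / (k + l).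
      rewrite mulrDl /s /t; congr (_ + _).
        by rewrite mulrAC [k * _]mulrC divfK// gt_eqF.
      by rewrite mulrAC [l * _]mulrC divfK// gt_eqF.
    by rewrite ler_wpM2r ?invr_ge0 ?(ltW kl0)//; exact: hfg.
rewrite ge0_integralD//; last 4 first.
- by move=> y _; rewrite -EFinM lee_fin mulr_ge0// N_function_ge0.
- by apply: measurable_funeM; exact: measurable_modular.
- by move=> y _; rewrite -EFinM lee_fin mulr_ge0// N_function_ge0.
- by apply: measurable_funeM; exact: measurable_modular.
rewrite !ge0_integralZl_EFin//; last 4 first.
- by move=> y _; rewrite lee_fin N_function_ge0.
- exact: measurable_modular.
- by move=> y _; rewrite lee_fin N_function_ge0.
- exact: measurable_modular.
apply: (@le_trans _ _ (s%:E * 1 + t%:E * 1)%E).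
  by apply: leeD; apply: lee_wpmul2l; rewrite ?lee_fin.
by rewrite !mule1 -EFinD st.
Qed.

(** By convexity, dividing the argument by [c + 1] divides a finite modular [c] by at least [c + 1],
    which brings it below 1. The added 1 makes the factor admissible in [N_function_scale]. *)
Lemma LPhi_gauge_ball u f : LPhi gr lam Phi u f -> exists k, gauge_ball u k f.
Proof.
move=> [mf [a [a0]]]; set I := (\int[lam u]_(y in _) _)%E => Ioo.
have Ige : (0 <= I)%E by apply: integral_ge0 => y _; rewrite lee_fin N_function_ge0.
have Ifin : I \is a fin_num by rewrite ge0_fin_numE.
pose c := fine I; have c0 : 0 <= c by exact: fine_ge0.
have c1 : 0 < c + 1 by rewrite ltr_wpDl.
exists ((c + 1) / a); split; first by rewrite divr_gt0.
apply: (@le_trans _ _ (\int[lam u]_(y in F u) ((c + 1)^-1%:E * (Phi (`|f y| / a^-1))%:E))%E).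
  apply: ge0_le_integral => //.
  - by move=> y _; rewrite lee_fin N_function_ge0.
  - exact: measurable_modular.
  - by apply: measurable_funeM; exact: measurable_modular.
  - move=> y _; rewrite -EFinM lee_fin invrK invf_div mulrA [_ / (c + 1)]mulrC.
    apply: N_function_scale => //; rewrite invr_ge0 (ltW c1)/=.
    by rewrite invf_le1// lerDr.
rewrite ge0_integralZl_EFin//; last 3 first.
- by move=> y _; rewrite lee_fin N_function_ge0.
- exact: measurable_modular.
- by rewrite invr_ge0 ltW.
under eq_integral do rewrite invrK mulrC.
rewrite -/I -(fineK Ifin) -/c -EFinM lee_fin mulrC ler_pdivrMr// mul1r lerDl//.
Qed.

Lemma gauge_ball_LPhi u k f : fmeasurable u f -> gauge_ball u k f -> LPhi gr lam Phi u f.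
Proof.
move=> mf [k0 fk]; split => //; exists k^-1; split; first by rewrite invr_gt0.
by under eq_integral do rewrite mulrC; apply: le_lt_trans fk _; rewrite ltry.
Qed.

(** Membership in [LPhi] makes the set of admissible radii nonempty, which excludes the default
    value 0 of [inf] on the empty set. *)
Lemma gauge_norm_lt u e f : LPhi gr lam Phi u f ->
  gauge_norm gr lam Phi u f < e -> gauge_ball u e f.
Proof.
move=> Lf fe; have [k0 Bk0] := LPhi_gauge_ball u f Lf.
have [|k Bk ke] := @inf_lt _ [set k | gauge_ball u k f] e _ fe; first by exists k0.
by apply: (gauge_ball_le u k) => //; [exact: (proj1 Lf)|exact: ltW].
Qed.

Lemma gauge_norm_le u k f : gauge_ball u k f -> gauge_norm gr lam Phi u f <= k.
Proof.
move=> Bk; apply: ge_inf => //; exists 0 => l [l0 _]; exact: ltW.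
Qed.

End GaugeBall.
Arguments gauge_ball {R G} gr lam Phi u k f.

(** * Translations and compactly supported functions in the fibre spaces *)

Section CompactSupportGauge.
Context {R : realType} {G : ptopologicalType} {gr : groupoid G}
  {lam : G -> {measure set (borelT G) -> \bar R}} {Phi : R -> R}.
Hypothesis hG : hausdorff_space G.
Hypothesis lcG : locally_compact [set: G].
Hypothesis tG : topological_groupoid gr.
Hypothesis haar : haar_system gr lam.
Hypothesis hPhi : N_function Phi.
Local Notation inv := (ginv gr).
Local Notation mul := (gmul gr).
Local Notation r := (grange gr).
Local Notation d := (gsource gr).
Local Notation F := (fibre gr).
Local Notation fmeasurable u f :=
  (measurable_fun (F u : set (borelT G)) (f : borelT G -> R)).
Local Notation ball := (gauge_ball gr lam Phi).
Local Notation LP := (LPhi gr lam Phi).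

Local Hint Extern 0 (measurable (fibre _ _)) => (exact: fibre_borel hG tG _) : core.

Lemma LPhi_sub u f g : LP u f -> LP u g -> LP u (f \- g).
Proof.
move=> Lf Lg; have [k Bk] := LPhi_gauge_ball hG tG hPhi u f Lf.
have [l Bl] := LPhi_gauge_ball hG tG hPhi u g Lg.
have mfg : fmeasurable u (f \- g) by apply: measurable_funB; [exact: (proj1 Lf)|exact: (proj1 Lg)].
apply: (gauge_ball_LPhi u (k + l)) => //.
apply: (gauge_ball_add hG tG hPhi u k l f g) => //; [exact: (proj1 Lf)|exact: (proj1 Lg)|].
by move=> y _ /=; exact: ler_normB.
Qed.

Lemma gauge_ball_sym u k f g : LP u f -> LP u g ->
  ball u k (f \- g) -> ball u k (g \- f).
Proof.
move=> Lf Lg Bfg; have [k0 _] := Bfg.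
apply: (gauge_ball_dom hG tG hPhi u k k _ (f \- g)) => //.
- by have [] := LPhi_sub u g f Lg Lf.
- by have [] := LPhi_sub u f g Lf Lg.
- by move=> y _ /=; rewrite distrC.
Qed.

Lemma gauge_ball_triangle u k l f g h : LP u f -> LP u g -> LP u h ->
  ball u k (f \- g) -> ball u l (g \- h) -> ball u (k + l) (f \- h).
Proof.
move=> Lf Lg Lh; apply: (gauge_ball_add hG tG hPhi u k l (f \- g) (g \- h)).
- by have [] := LPhi_sub u f g Lf Lg.
- by have [] := LPhi_sub u g h Lg Lh.
- by have [] := LPhi_sub u f h Lf Lh.
- by move=> y _ /=; exact: ler_distD.
Qed.

Lemma fmeasurable_translate x f : fmeasurable (d x) f -> fmeasurable (r x) (Ltrans gr x f).
Proof.
move=> mf; apply: (measurable_comp (fibre_borel hG tG (d x)) _ mf).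
  by move=> _ [y Fy <-]; rewrite /fibre/= grange_mulV// Fy.
by have := measurable_translate hG tG (inv x); rewrite gsource_inv.
Qed.

Lemma integral_modular_translate x f c : fmeasurable (d x) f -> 0 < c ->
  (\int[lam (r x)]_(y in F (r x)) (Phi (`|Ltrans gr x f y| / c))%:E =
   \int[lam (d x)]_(y in F (d x)) (Phi (`|f y| / c))%:E)%E.
Proof.
move=> mf c0.
apply: (integral_translate hG lcG tG haar x (fun y => (Phi (`|f y| / c))%:E)).
  exact: measurable_modular.
by move=> y _; rewrite lee_fin N_function_ge0.
Qed.

Lemma gauge_ball_translate x k f : fmeasurable (d x) f ->
  ball (r x) k (Ltrans gr x f) <-> ball (d x) k f.
Proof.
move=> mf; rewrite /gauge_ball; split => -[k0].
  by rewrite integral_modular_translate.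
by rewrite -integral_modular_translate.
Qed.

Lemma LPhi_translate x f : LP (d x) f -> LP (r x) (Ltrans gr x f).
Proof.
move=> Lf; have [k Bk] := LPhi_gauge_ball hG tG hPhi _ f Lf.
apply: (gauge_ball_LPhi _ k); first exact: fmeasurable_translate (proj1 Lf).
by apply/gauge_ball_translate => //; exact: (proj1 Lf).
Qed.

Lemma gauge_norm_translate x f : LP (d x) f ->
  gauge_norm gr lam Phi (r x) (Ltrans gr x f) = gauge_norm gr lam Phi (d x) f.
Proof.
move=> [mf _]; congr inf; apply/seteqP.
by split => k /(gauge_ball_translate x k f mf).
Qed.

Lemma Cc_sub (f g : G -> R) : Cc f -> Cc g -> Cc (f \- g).
Proof.
move=> [cf sf] [cg sg]; split.
  by move=> x; apply: continuousB; [exact: cf|exact: cg].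
apply: (subclosed_compact (@closed_closure _ _) (compactU sf sg)).
rewrite -closureU; apply: closureS => x /=.
have [->|/eqP fx] := eqVneq (f x) 0; last by left.
by rewrite sub0r => gx; right => gx0; apply: gx; rewrite gx0 oppr0.
Qed.

(** As [Phi] vanishes at 0, the support does not grow; the modular integrand is thus a test function
    for continuity of the Haar system. *)
Lemma Cc_modular (h : G -> R) k : Cc h -> Cc (fun y => Phi (`|h y| / k)).
Proof.
move=> [ch sh]; split.
  move=> x; apply: continuous_comp; last exact: N_function_continuous.
  apply: continuousM; last exact: cvg_cst.
  by apply: continuous_comp; [exact: ch|exact: norm_continuous].
apply: (subclosed_compact (@closed_closure _ _) sh).
apply: closureS => x /= Px hx; apply: Px.
by rewrite hx normr0 mul0r N_function0.
Qed.

Lemma Cc_integral_lty u (q : G -> R) : unit_space gr u -> Cc q ->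
  (forall y, 0 <= q y) -> (\int[lam u]_y (q y)%:E < +oo)%E.
Proof.
move=> uu [cq sq] q0; have [/(_ u uu) [fink _ _] _ _ _] := haar.
set S := closure _ in sq.
have mS : measurable (S : set (borelT G)) by apply: closed_borel; exact: closed_closure.
have [M M0 qM] := continuous_compact_bound _ q sq (continuous_subspaceT cq).
have mq := continuous_borel_real _ cq.
apply: (@le_lt_trans _ _ (\int[lam u]_y (M%:E * (\1_S y)%:E))%E).
  apply: ge0_le_integral => //.
  - by move=> y _; rewrite lee_fin.
  - exact/measurable_EFinP.
  - apply: measurable_funeM; apply/measurable_EFinP; exact: measurable_indic.
  - move=> y _; rewrite -EFinM lee_fin indicE; have [|] := boolP (y \in S).
      by rewrite inE mulr1 => /qM; apply: le_trans; exact: ler_norm.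
    rewrite notin_setE mulr0 => Sy; rewrite (_ : q y = 0)//.
    by apply: contra_notP Sy => qy; exact: subset_closure.
rewrite ge0_integralZl_EFin ?(ltW M0)//.
- rewrite integral_indic// setIT; apply: lte_mul_pinfty; rewrite ?lee_fin ?(ltW M0)//.
  exact: fink.
- by apply/measurable_EFinP; exact: measurable_indic.
Qed.

Lemma Cc_fmeasurable u (h : G -> R) : Cc h -> fmeasurable u h.
Proof. by move=> [ch _]; apply: measurable_funTS; exact: continuous_borel_real. Qed.

Lemma Cc_integral_modular u (h : G -> R) k : unit_space gr u -> Cc h ->
  (\int[lam u]_(y in F u) (Phi (`|h y| / k))%:E = \int[lam u]_y (Phi (`|h y| / k))%:E)%E.
Proof.
move=> uu Ch; apply: (integral_fibre hG tG haar) => //.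
  by apply/measurable_EFinP; apply: continuous_borel_real; have [] := Cc_modular h k Ch.
by move=> y; rewrite lee_fin N_function_ge0.
Qed.

Lemma Cc_LPhi u (h : G -> R) : unit_space gr u -> Cc h -> LP u h.
Proof.
move=> uu Ch; split; first exact: Cc_fmeasurable.
exists 1; split => //; under eq_integral do rewrite mulrC -invr1.
rewrite Cc_integral_modular//; apply: Cc_integral_lty => //; first exact: Cc_modular.
by move=> y; exact: N_function_ge0.
Qed.

(* Enlarging the radius makes the modular strictly less than 1, an open condition. *)
Lemma gauge_ball_Cc_near u0 k k' (h : G -> R) : unit_space gr u0 -> Cc h ->
  ball u0 k h -> k < k' ->
  \forall u \near u0, unit_space gr u -> ball u k' h.
Proof.
move=> uu0 Ch [k0 hk] kk'; have k'0 : 0 < k' by exact: lt_trans kk'.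
have kk01 : 0 <= k / k' <= 1.
  by rewrite divr_ge0 ?(ltW k0) ?(ltW k'0)//= ler_pdivrMr// mul1r ltW.
(* Convexity scales the modular by [k / k'], which is less than 1. *)
have lt1 : (\int[lam u0]_y (Phi (`|h y| / k'))%:E < 1)%E.
  rewrite -Cc_integral_modular//.
  apply: (@le_lt_trans _ _ (\int[lam u0]_(y in F u0) ((k / k')%:E * (Phi (`|h y| / k))%:E))%E).
    apply: ge0_le_integral => //.
    - by move=> y _; rewrite lee_fin N_function_ge0.
    - by apply: measurable_modular => //; exact: Cc_fmeasurable.
    - apply: measurable_funeM; apply: measurable_modular => //; exact: Cc_fmeasurable.
    - move=> y _; rewrite -EFinM lee_fin.
      have -> : `|h y| / k' = k / k' * (`|h y| / k).
        by rewrite mulrAC [k * _]mulrC divfK// gt_eqF.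
      exact: N_function_scale.
  rewrite ge0_integralZl_EFin//; last 3 first.
  - by move=> y _; rewrite lee_fin N_function_ge0.
  - by apply: measurable_modular => //; exact: Cc_fmeasurable.
  - by have /andP[] := kk01.
  apply: (@le_lt_trans _ _ ((k / k')%:E * 1)%E).
    by apply: lee_wpmul2l => //; rewrite lee_fin; have /andP[] := kk01.
  by rewrite mule1 lte_fin ltr_pdivrMr// mul1r.
have [_ _ /(_ _ (Cc_modular h k' Ch)) + _] := haar.
move=> /subspace_continuousP/(_ u0 uu0) H.
have : nbhs u0 [set u | unit_space gr u -> (\int[lam u]_y (Phi (`|h y| / k'))%:E < 1)%E].
  apply: (H [set e | (e < 1)%E]); apply: open_nbhs_nbhs; split => //.
  exact: open_ereal_lt_ereal.
apply: filterS => u Hu uu; split => //.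
by rewrite Cc_integral_modular// ltW// Hu.
Qed.

(** Compactness of [C] reduces the claim to pairs near [(y, x0)] for one [y]. If [r y] differs from
    [r x0], nearby pairs have different ranges too; otherwise the difference is continuous along
    pairs of equal range and vanishes at [(y, x0)]. *)
Lemma translate_near (x0 : G) (f h : G -> R) (C : set G) (e : R) :
  continuous f -> continuous h -> compact C -> 0 < e ->
  (forall y, F (r x0) y -> h y = f (mul (inv x0) y)) ->
  \forall x \near x0, forall y, C y -> r y = r x -> `|f (mul (inv x) y) - h y| <= e.
Proof.
move=> cf ch /compact_near_coveringP cC e0 hf.
have cinv := proj1 tG; have cr := continuous_grange gr tG.
apply: (cC _ (nbhs x0) (fun x y => r y = r x -> `|f (mul (inv x) y) - h y| <= e)).
move=> y Cy; have [yx|yx] := pselect (r y = r x0); last first.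
  have : nbhs (y, x0) (~` [set p : G * G | r p.1 = r p.2]).
    apply: open_nbhs_nbhs; split => //; apply: closed_openC.
    apply: closed_eq2 => // p; apply: continuous_comp => //; try exact: cr.
      exact: cvg_fst.
    exact: cvg_snd.
  by apply: filterS => -[y' x'] /= n /n.
pose W := within [set p : G * G | r p.1 = r p.2] (nbhs (y, x0)).
have c1 : (fun p : G * G => p.1) @ W --> y by apply: cvg_within_filter; exact: cvg_fst.
have c2 : (fun p : G * G => inv p.2) @ W --> inv x0.
  apply: cvg_within_filter.
  by apply: (@cvg_comp _ _ _ snd inv _ (nbhs x0)); [exact: cvg_snd|exact: cinv].
have cm : (fun p : G * G => mul (inv p.2) p.1) @ W --> mul (inv x0) y.
  apply: (gmul_cvg gr tG _ (fun p : G * G => inv p.2) (fun p => p.1)) => //.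
    by rewrite gsource_inv yx.
  by rewrite near_withinE; apply: nearW => -[y' x'] /= yx'; rewrite gsource_inv yx'.
have cd : (fun p : G * G => f (mul (inv p.2) p.1) - h p.1) @ W --> f (mul (inv x0) y) - h y.
  apply: cvgB.
    exact: (cvg_comp _ _ cm (cf _)).
  exact: (cvg_comp _ _ c1 (ch _)).
rewrite hf ?subrr// in cd.
have /cvgr0Pnorm_le/(_ e e0) := cd.
by rewrite near_withinE; apply: filterS => -[y' x'].
Qed.

Lemma translate_approx (x0 : G) (f : G -> R) : Cc f ->
  exists2 h : G -> R, Cc h &
    (forall y, F (r x0) y -> h y = f (mul (inv x0) y)) /\
    forall e, 0 < e -> \forall x \near x0, ball (r x) e (Ltrans gr x f \- h).
Proof.
move=> [cf sf]; set S := closure _ in sf.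
have [K] := lcG x0 I; rewrite withinET => Kx0 [cK clK].
(* Composability is the closed condition [d p.1 = r p.2], so [E] is compact. Its image [C1] under
   multiplication contains, within [F (r x)], every point where [L(x) f] is nonzero, for all [x] in
   [K]. *)
pose E := (K `*` S) `&` [set p : G * G | gcomposable gr p.1 p.2].
have cE : compact E.
  apply: compact_closedI; first exact: compact_setX.
  rewrite (_ : [set p | _] = [set p : G * G | d p.1 = r p.2]).
    apply: closed_eq2 => // p; apply: continuous_comp.
    - exact: cvg_fst.
    - exact: continuous_gsource.
    - exact: cvg_snd.
    - exact: continuous_grange.
  by apply/seteqP; split => p /= /gcomposableP.
pose C1 := (fun p : G * G => mul p.1 p.2) @` E.
have cC1 : compact C1.
  apply: continuous_compact cE; apply: continuous_subspaceW (proj2 tG).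
  exact: subIsetr.
have C1P x y : K x -> F (r x) y -> f (mul (inv x) y) <> 0 -> C1 y.
  move=> Kx Fy fy; exists (x, mul (inv x) y) => /=; last by rewrite gmulKr.
  split; first by split => //=; exact: subset_closure.
  by apply/gcomposableP; rewrite grange_mulV.
have wf : {within F (r x0), continuous (fun y => f (mul (inv x0) y))}.
  have := within_continuous_translate gr tG (inv x0); rewrite gsource_inv => wc.
  move=> y; apply: (@continuous_comp _ _ _ (mul (inv x0) : subspace (F (r x0)) -> G)).
    exact: wc.
  exact: cf.
have [|h Ch hE] := Cc_extension hG lcG _ C1 _ (closed_fibre gr hG tG (r x0)) wf cC1.
  by move=> y Fy; apply: C1P => //; exact: nbhs_singleton.
exists h => //; split => // e e0; have [ch sh] := Ch.
pose C := C1 `|` closure (h @^-1` [set~ 0]).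
have cC : compact C by exact: compactU.
(* Since [phi] is 1 on [C], its gauge norm, bounded by [k + 1] near [x0], turns a uniform error
   [e / (k + 1)] on [C] into a gauge error [e]. Off [C] both functions vanish on the fibre. *)
have [phi [Cphi _ phi1 _]] := @Cc_urysohn R G hG lcG C setT cC openT (@subsetT _ _).
have ux0 := unit_space_range gr x0.
have [k Bk] := LPhi_gauge_ball hG tG hPhi _ _ (Cc_LPhi _ _ ux0 Cphi).
have k0 : 0 < k + 1 by have [k0 _] := Bk; rewrite addr_gt0.
have nk : \forall x \near x0, ball (r x) (k + 1) phi.
  have kk1 : k < k + 1 by rewrite ltrDl.
  have : \forall x \near x0, unit_space gr (r x) -> ball (r x) (k + 1) phi.
    exact: (continuous_grange gr tG x0 _ (gauge_ball_Cc_near _ _ _ _ ux0 Cphi Bk kk1)).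
  by apply: filterS => x; apply; exact: unit_space_range.
have ek : 0 < e / (k + 1) by rewrite divr_gt0.
have nC := translate_near x0 f h C _ cf ch cC ek hE.
apply: filterS (filterI (filterI Kx0 nk) nC) => x [[Kx kx] Cx].
have mL : fmeasurable (r x) (Ltrans gr x f).
  by apply: fmeasurable_translate; exact: Cc_fmeasurable.
apply: (gauge_ball_dom hG tG hPhi _ (k + 1) e _ phi) => //.
- by apply: measurable_funB => //; exact: Cc_fmeasurable.
- exact: Cc_fmeasurable.
- move=> y Fy; rewrite /= -/(Ltrans gr x f y); have [Cy|nCy] := pselect (C y).
    rewrite phi1// normr1 ler_pdivrMr// mulrC mul1r.
    exact: Cx.
  have -> : Ltrans gr x f y = 0.
    rewrite /Ltrans; apply: contra_notP nCy => fy; left; exact: (C1P x).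
  have -> : h y = 0.
    by apply: contra_notP nCy => hy; right; exact: subset_closure.
  by rewrite subrr normr0 mul0r divr_ge0// ltW.
Qed.

End CompactSupportGauge.

(** * Strong continuity *)

(** Every open set around [f x0] contains a finite intersection of subbasic sets around it, so
    finitely many neighbourhoods of [x0] are intersected. *)
Lemma continuous_total_space {R : realType} {G : ptopologicalType} {gr : groupoid G}
    {lam : G -> {measure set (borelT G) -> \bar R}} {Phi : R -> R}
    {X : topologicalType} (f : X -> total_space gr lam Phi) (x0 : X) :
  (forall i, @total_subbase_dom R G gr lam Phi i -> @total_subbase R G gr lam Phi i (f x0) ->
     \forall x \near x0, @total_subbase R G gr lam Phi i (f x)) ->
  {for x0, continuous f}.
Proof.
move=> H A; rewrite nbhsE => -[B [oB Bx] BA].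
apply: (@filterS _ (nbhs x0) _ (f @^-1` B)); first by move=> x /BA.
have [D' D'sub DB] := oB.
move: Bx; rewrite -DB => -[C D'C Cx].
have [S Ssub SC] := D'sub _ D'C.
have SN : nbhs x0 (\bigcap_(i in [set` S]) (f @^-1` @total_subbase R G gr lam Phi i)).
  apply: filter_bigI => i iS; apply: H; first by have /Ssub := iS; rewrite inE.
  by move: Cx; rewrite -SC; apply.
apply: filterS SN => x Sx; exists C => //.
have CE : C (f x) by rewrite -SC => i iS; exact: Sx.
exact: CE.
Qed.

Section StrongContinuity.
Context {R : realType} {G : ptopologicalType} {gr : groupoid G}
  {lam : G -> {measure set (borelT G) -> \bar R}} {Phi : R -> R}.
Hypothesis hG : hausdorff_space G.
Hypothesis lcG : locally_compact [set: G].
Hypothesis tG : topological_groupoid gr.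
Hypothesis haar : haar_system gr lam.
Hypothesis hPhi : N_function Phi.
Local Notation r := (grange gr).
Local Notation d := (gsource gr).
Local Notation F := (fibre gr).
Local Notation L := (Ltrans gr).
Local Notation ball := (gauge_ball gr lam Phi).
Local Notation LP := (LPhi gr lam Phi).
Local Notation N := (gauge_norm gr lam Phi).

(* [h] stands for L(x0) f near x0, so the problem is moved to the compactly
   supported function [h - g], whose gauge norm is upper semicontinuous. *)
Lemma gauge_norm_translate_near (eta zeta : G -> G -> R) (x0 : G) (e : R) :
  Delta1 gr lam Phi eta -> Delta1 gr lam Phi zeta ->
  N (r x0) (L x0 (eta (d x0)) \- zeta (r x0)) < e ->
  \forall x \near x0, N (r x) (L x (eta (d x)) \- zeta (r x)) < e.
Proof.
move=> [Leta eta_approx] [Lzeta zeta_approx] Ne.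
have ur x := unit_space_range gr x; have ud x := unit_space_source gr x.
have L1 x : LP (r x) (L x (eta (d x))) by apply: LPhi_translate => //; exact: Leta.
(* The final chain of estimates has radius [e' + 6 * dl]; the seventh [dl] keeps the inequality
   strict. *)
set n := N _ _ in Ne; pose e' := (n + e) / 2; pose dl := (e - e') / 7.
have ne' : n < e' by rewrite /e' midf_lt.
have e'e : e' < e by rewrite /e' midf_lt.
have dl0 : 0 < dl by rewrite divr_gt0// subr_gt0.
have B0 : ball (r x0) e' (L x0 (eta (d x0)) \- zeta (r x0)).
  by apply: (gauge_norm_lt hG tG hPhi) => //; apply: LPhi_sub => //; exact: Lzeta.
have [f [Cf [V [oV Vd fV]]]] := eta_approx _ (ud x0) dl dl0.
have [g [Cg [W [oW Wr gW]]]] := zeta_approx _ (ur x0) dl dl0.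
have [h Ch [hE hx]] := translate_approx hG lcG tG haar hPhi x0 f Cf.
have LCc u k : unit_space gr u -> Cc k -> LP u k by exact: Cc_LPhi.
(* [L x] commutes with differences by computation, so this is the isometry applied to
   [eta (d x) \- f]. *)
have B1 x : V (d x) -> ball (r x) dl (L x (eta (d x)) \- L x f).
  move=> Vx; have Ld : LP (d x) (eta (d x) \- f).
    by apply: LPhi_sub => //; [exact: Leta|exact: LCc].
  apply/(gauge_ball_translate hG lcG tG haar hPhi x dl (eta (d x) \- f)).
    by have [] := Ld.
  by apply: (gauge_norm_lt hG tG hPhi) => //; exact: fV.
have B2 u : unit_space gr u -> W u -> ball u dl (zeta u \- g).
  move=> uu Wu; apply: (gauge_norm_lt hG tG hPhi); last exact: gW.
  by apply: LPhi_sub => //; [exact: Lzeta|exact: LCc].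
have LLf x : LP (r x) (L x f) by apply: LPhi_translate => //; exact: LCc.
(* On the fibre over [r x0], [h] is [L x0 f]; the chain runs from [L x0 f] through
   [L x0 (eta (d x0))] and [zeta (r x0)] to [g]. *)
have Bhg : ball (r x0) (dl + e' + dl) (h \- g).
  apply: (gauge_ball_dom hG tG hPhi _ (dl + e' + dl) _ _ (L x0 f \- g)).
  - by have [] := LPhi_sub hG tG hPhi _ _ _ (LCc _ _ (ur x0) Ch) (LCc _ _ (ur x0) Cg).
  - by have [] := LPhi_sub hG tG hPhi _ _ _ (LLf x0) (LCc _ _ (ur x0) Cg).
  - by have [e'0 _] := B0; rewrite !addr_gt0.
  - by move=> y Fy /=; rewrite hE.
  apply: (gauge_ball_triangle hG tG hPhi _ _ _ _ (zeta (r x0))) => //.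
  - exact: Lzeta.
  - exact: LCc.
  - apply: (gauge_ball_triangle hG tG hPhi _ _ _ _ (L x0 (eta (d x0)))) => //.
    + exact: Lzeta.
    + by apply: gauge_ball_sym => //; exact: B1.
  - exact: B2.
have Bhg' : dl + e' + dl < dl + e' + dl + dl by rewrite ltrDl.
have cr := continuous_grange gr tG; have cd := continuous_gsource gr tG.
have nhg : \forall x \near x0, unit_space gr (r x) ->
    ball (r x) (dl + e' + dl + dl) (h \- g).
  exact: (cr x0 _ (gauge_ball_Cc_near hG tG haar hPhi _ _ _ _ (ur x0) (Cc_sub _ _ Ch Cg) Bhg Bhg')).
have nV : nbhs x0 (d @^-1` V) by apply: cd; exact: open_nbhs_nbhs.
have nW : nbhs x0 (r @^-1` W) by apply: cr; exact: open_nbhs_nbhs.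
apply: filterS (filterI (filterI nV nW) (filterI nhg (hx dl dl0))) => x [[Vx Wx] [hgx Bx]].
have {}hgx := hgx (ur x).
(* At [x] the chain runs from [L x (eta (d x))] through [L x f], [h] and [g] to [zeta (r x)]. *)
have Bfin : ball (r x) (dl + dl + (dl + e' + dl + dl) + dl) (L x (eta (d x)) \- zeta (r x)).
  apply: (gauge_ball_triangle hG tG hPhi _ _ _ _ g) => //.
  - exact: LCc.
  - exact: Lzeta.
  - apply: (gauge_ball_triangle hG tG hPhi _ _ _ _ h) => //; try exact: LCc.
    apply: (gauge_ball_triangle hG tG hPhi _ _ _ _ (L x f)) => //; try exact: LCc.
    exact: B1.
  - apply: (gauge_ball_sym hG tG hPhi _ _ (zeta (r x)) g); [exact: Lzeta|exact: LCc|exact: B2].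
apply: (le_lt_trans (gauge_norm_le _ _ _ Bfin)).
have -> : e = e' + 7 * dl by rewrite /dl mulrC divfK// addrC subrK.
lra.
Qed.

End StrongContinuity.

Theorem theorem3p8 (R : realType) (G : ptopologicalType) (gr : groupoid G)
  (lam : G -> {measure set (borelT G) -> \bar R}) (Phi Psi : R -> R) :
  hausdorff_space G -> locally_compact [set: G] -> @second_countable G ->
  topological_groupoid gr ->
  haar_system gr lam ->
  N_function Phi -> N_function Psi -> Psi = complementary Phi ->
  Delta2 G Phi ->
  let r := grange gr in let d := gsource gr in
  let L := Ltrans gr in
  (* (i) each L(x) : L^Phi(G^{d x}) -> L^Phi(G^{r x}) is an invertible isometry *)
  (forall x : G,
     (forall f, LPhi gr lam Phi (d x) f ->
        LPhi gr lam Phi (r x) (L x f) /\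
        gauge_norm gr lam Phi (r x) (L x f) = gauge_norm gr lam Phi (d x) f) /\
     (forall f g, LPhi gr lam Phi (d x) f -> LPhi gr lam Phi (d x) g ->
        fibre_ae_eq gr lam (r x) (L x f) (L x g) -> fibre_ae_eq gr lam (d x) f g) /\
     (forall g, LPhi gr lam Phi (r x) g ->
        exists2 f, LPhi gr lam Phi (d x) f & fibre_ae_eq gr lam (r x) (L x f) g)) /\
  (* (ii) L(u) is the identity of L^Phi(G^u) for u in G^0 *)
  (forall u, unit_space gr u -> forall f, LPhi gr lam Phi u f ->
     fibre_ae_eq gr lam u (L u f) f) /\
  (* (iii) L(x) L(y) = L(xy) for composable (x, y) *)
  (forall x y, gcomposable gr x y -> forall f, LPhi gr lam Phi (d y) f ->
     fibre_ae_eq gr lam (r x) (L x (L y f)) (L (gmul gr x y) f)) /\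
  (* (iv) L(x)^{-1} = L(x^{-1}) *)
  (forall x,
     (forall f, LPhi gr lam Phi (d x) f ->
        fibre_ae_eq gr lam (d x) (L (ginv gr x) (L x f)) f) /\
     (forall g, LPhi gr lam Phi (r x) g ->
        fibre_ae_eq gr lam (r x) (L x (L (ginv gr x) g)) g)) /\
  (* (v) strong continuity: x |-> L(x) eta^{d(x)} is continuous G -> L_0^Phi *)
  (forall eta, Delta1 gr lam Phi eta ->
     continuous (fun x : G =>
       ((r x, L x (eta (d x))) : total_space gr lam Phi))).
Proof.
move=> hG lcG _ tG haar hPhi _ _ _ r d L.
split.
  move=> x; split; [|split].
- by move=> f Lf; split; [exact: LPhi_translate|exact: gauge_norm_translate].
(* The null set [A] containing the points where the translates differ is pulled back along [mul x],
   and [haar_translate] keeps it null. *)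
- move=> f g _ _ [A [mA A0 sub]].
  exists (fibre gr (d x) `&` gmul gr x @^-1` A); split.
  + exact: (measurable_translate hG tG x (fibre_borel hG tG _) _ mA).
  + by rewrite (haar_translate hG lcG tG haar x _ mA).
  + move=> y /= /not_implyP [Fy fg]; split => //; apply: sub => /= H; apply: fg.
    have := H _; rewrite /L /Ltrans gmulK//; apply.
    by rewrite /fibre/= grange_mul// Fy.
- move=> g Lg; exists (Ltrans gr (ginv gr x) g).
    have := LPhi_translate hG lcG tG haar hPhi (ginv gr x) g.
    by rewrite gsource_inv grange_inv; exact.
  by apply: aeW => y Fy; rewrite /L /Ltrans ginvK gmulKr// Fy.
split; first by move=> u uu f _; apply: aeW => y Fy; rewrite /L /Ltrans gmul_invl_unit.
split.
  move=> x y /gcomposableP xy f _; apply: aeW => w Fw.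
  by rewrite /L /Ltrans gmul_invM.
split.
  move=> x; split=> f _; apply: aeW => w Fw.
    by rewrite /L /Ltrans ginvK gmulK// Fw.
  by rewrite /L /Ltrans ginvK gmulKr// Fw.
move=> eta Deta x0; apply: continuous_total_space.
move=> [[V zeta] e] [/= oV Dzeta e0] [/= _ _ Vx Ne].
have nV : nbhs x0 (r @^-1` V).
  by apply: continuous_grange => //; exact: open_nbhs_nbhs.
have nN := gauge_norm_translate_near hG lcG tG haar hPhi _ _ _ _ Deta Dzeta Ne.
apply: filterS (filterI nV nN) => x [Vrx Nx]; split => //=.
- exact: unit_space_range.
- by apply: LPhi_translate => //; apply: (proj1 Deta); exact: unit_space_source.
Qed.
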